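(* Let $X$ and $Y$ be Banach spaces (both real or both complex), and let $U$ and $V$ be closed subspaces of $X$ and $Y$, respectively. Let $S\in \mathcal{F}(Y^*,X^* )$ satisfy $S(V^\perp)\subset U^\perp$. Let $F$ be a finite-dimensional subspace of $Y^*$. Then there exists a net $(T_\alpha)\subset\mathcal{F}(X,Y)$ satisfying $T_\alpha(U)\subset V$ for all $\alpha$ such that (1) $\| T_\alpha\|\to\| S\|$; (2) $\operatorname{ran} T_\alpha^*=\operatorname{ran} S$ for all $\alpha$; (3) $T_\alpha^*y^*\to Sy^*$ for all $y^*\in Y^*$, and in particular $T_\alpha^*y^*=Sy^*$ for all $\alpha$ and all $y^*\in F$; (4) $T_\alpha^{**}x^{**}=S^*x^{**}$ for all $\alpha$ and for all those $x^{**}\in X^{**}$ for which $S^*x^{**}\in Y$. Moreover, if $X=Y$ and $S$ is a projection, then the operators $T_\alpha$ can also be taken to be projections.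
   Context: For Banach spaces $X,Y$, $\mathcal{F}(X,Y)$ denotes the space of bounded linear finite-rank operators from $X$ to $Y$. For a subspace $U$ of $X$, $U^\perp=\{x^*\in X^*: x^*(x)=0\ \forall x\in U\}$ is its annihilator. Banach spaces are regarded as subspaces of their biduals via the canonical embedding; $\operatorname{ran}$ denotes range. Convergence in (3) is in norm. *)

(* Defs.v *)
From HB Require Import structures.
From mathcomp Require Import all_boot all_order all_algebra.
From mathcomp Require Import all_classical all_reals all_analysis.
From mathcomp Require complex.
Set Implicit Arguments. Unset Strict Implicit. Unset Printing Implicit Defensive.
Import Order.TTheory GRing.Theory Num.Theory.
Import numFieldNormedType.Exports.
Local Open Scope classical_set_scope.
Local Open Scope ring_scope.

(* Scalars K (= R or R[i]); nr : K -> R turns (real) norm values into reals. *)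
Section BanachDefs.
Variables (R : realType) (K : numFieldType) (nr : K -> R).

Definition dual (X : normedModType K) : set (X -> K) :=
  [set f | (forall (a : K) (x y : X), f (a *: x + y) = a * f x + f y)
           /\ continuous f].

Definition dnorm (X : normedModType K) (f : X -> K) : R :=
  sup [set nr `|f x| | x in [set x : X | `|x| <= 1]].

Definition bidual (X : normedModType K) : set ((X -> K) -> K) :=
  [set P | (forall (a : K) (f g : X -> K), dual f -> dual g ->
              P (fun x => a * f x + g x) = a * P f + P g)
           /\ exists M : R, forall f, dual f -> nr `|P f| <= M * dnorm f].

Definition canon (X : normedModType K) (x : X) : (X -> K) -> K := fun f => f x.
Definition in_space (Y : normedModType K) (P : (Y -> K) -> K) : Prop :=
  exists y : Y, forall g, dual g -> P g = canon y g.

Definition dual_fin_rank_op (X Y : normedModType K)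
  (S : (Y -> K) -> (X -> K)) : Prop :=
  [/\ forall g, dual g -> dual (S g),
      forall (a : K) g h, dual g -> dual h ->
        S (fun y => a * g y + h y) = (fun x => a * S g x + S h x),
      exists M : R, forall g, dual g -> dnorm (S g) <= M * dnorm g
    & exists n (e : 'I_n -> X -> K), (forall i, dual (e i)) /\
        forall g, dual g -> exists c : 'I_n -> K,
          S g = (fun x => \sum_(i < n) c i * e i x)].

Definition dopnorm (X Y : normedModType K) (S : (Y -> K) -> (X -> K)) : R :=
  sup [set dnorm (S g) | g in [set g : Y -> K | dual g /\ dnorm g <= 1]].

Definition fin_rank_op (X Y : normedModType K) (T : X -> Y) : Prop :=
  [/\ forall (a : K) (x y : X), T (a *: x + y) = a *: T x + T y,
      continuous T
    & exists n (v : 'I_n -> Y), forall x, exists c : 'I_n -> K,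
        T x = \sum_(i < n) c i *: v i].

Definition opnorm (X Y : normedModType K) (T : X -> Y) : R :=
  sup [set nr `|T x| | x in [set x : X | `|x| <= 1]].

Definition closed_subspace (X : normedModType K) (U : set X) : Prop :=
  [/\ closed U, U 0 & forall (a : K) x y, U x -> U y -> U (a *: x + y)].

Definition annih (X : normedModType K) (U : set X) : set (X -> K) :=
  [set f | dual f /\ forall x, U x -> f x = 0].

Definition findim_dual_subspace (Y : normedModType K) (F : set (Y -> K)) :=
  [/\ F `<=` dual (X := Y), F (fun _ => 0),
      forall (a : K) g h, F g -> F h -> F (fun y => a * g y + h y)
    & exists n (e : 'I_n -> Y -> K), forall g, F g ->
        exists c : 'I_n -> K, g = (fun y => \sum_(i < n) c i * e i y)].

Definition directed (I : Type) (le : I -> I -> Prop) : Prop :=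
  [/\ inhabited I, forall i, le i i,
      forall i j k, le i j -> le j k -> le i k
    & forall i j, exists k, le i k /\ le j k].

Definition net_cvg (I : Type) (le : I -> I -> Prop) (a : I -> R) (l : R) :=
  forall e : R, 0 < e -> exists i0, forall i, le i0 i -> `|a i - l| < e.

Definition good_net (X Y : normedModType K) (U : set X) (V : set Y)
  (S : (Y -> K) -> (X -> K)) (F : set (Y -> K))
  (I : Type) (le : I -> I -> Prop) (T : I -> X -> Y) : Prop :=
  [/\ directed le /\ (forall i, fin_rank_op (T i)),
      forall i x, U x -> V (T i x),
      (* (1) *) net_cvg le (fun i => opnorm (T i)) (dopnorm S),
      (* (2) ran T_i^star = ran S *)
      (forall i, [set (fun x => g (T i x)) | g in dual (X := Y)]
                = [set S g | g in dual (X := Y)]) /\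
      (forall g, dual g ->
         net_cvg le (fun i => dnorm (fun x => g (T i x) - S g x)) 0)
      /\ (forall i g, F g -> (fun x => g (T i x)) = S g)
    & (* (4) T_i^starstar P = S^star P whenever S^star P lies in Y *)
      forall i (P : (X -> K) -> K), bidual P ->
        in_space (fun g => P (S g)) ->
        forall g, dual g -> P (fun x => g (T i x)) = P (S g)].

Definition theorem3p1_statement : Prop :=
  (forall (X Y : completeNormedModType K) (U : set X) (V : set Y)
          (S : (Y -> K) -> (X -> K)) (F : set (Y -> K)),
     closed_subspace U -> closed_subspace V -> dual_fin_rank_op S ->
     (forall g, annih V g -> annih U (S g)) ->
     findim_dual_subspace F ->
     exists (I : Type) (le : I -> I -> Prop) (T : I -> X -> Y),
       good_net U V S F le T)
  /\
  (forall (X : completeNormedModType K) (U V : set X)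
          (S : (X -> K) -> (X -> K)) (F : set (X -> K)),
     closed_subspace U -> closed_subspace V -> dual_fin_rank_op S ->
     (forall g, annih V g -> annih U (S g)) ->
     findim_dual_subspace F ->
     (forall g, dual g -> S (S g) = S g) ->
     exists (I : Type) (le : I -> I -> Prop) (T : I -> X -> X),
       good_net U V S F le T /\ forall i x, T i (T i x) = T i x).

End BanachDefs.

(* Main.v *)
(* Choose [h j] in the range of [S] and [x j] in [X] biorthogonal, with [S g] the sum
   of the [S g (x j) * h j]; an operator [T] of the required kind is a choice of
   vectors [t j] of [Y], [T u] being the sum of the [h j u *: t j].  The functionals
   [g |-> S g (x j)] are elements of the bidual of [Y] that would be perfect choices;
   Helly's theorem (Hahn-Banach on a sup-norm power of [Y]) replaces them by vectors
   of [Y] that agree with them on finitely many functionals and give almost the same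
   norm at finitely many points, which suffices because the coordinates of the unit
   ball of [X] are totally bounded.  Splitting the coordinate space along the
   coordinates of [U] and along those combinations whose image under the adjoint of
   [S] already lies in [Y] makes [T] map [U] into [V] and leaves the latter images
   unchanged.  Indexing by finite sets of functionals and precisions gives the net;
   equality of ranges and idempotence are forced by exactness on suitable finite sets
   of functionals. *)
Require Import Defs.
From HB Require Import structures.
From mathcomp Require Import all_boot all_order all_algebra.
From mathcomp Require Import all_classical all_reals all_analysis.
From mathcomp Require Import ring lra.
From mathcomp Require complex.
Import complex.ComplexField.
Set Implicit Arguments. Unset Strict Implicit. Unset Printing Implicit Defensive.
Import Order.TTheory GRing.Theory Num.Theory.
Import numFieldNormedType.Exports.
Local Open Scope classical_set_scope.
Local Open Scope ring_scope.

(** * Hahn-Banach through minimal sublinear functionals *)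

Section RealHahnBanach.
Variables (R : realType) (K : numFieldType) (iota : {rmorphism R -> K}).
Variable E : lmodType K.
Implicit Types (p q : E -> R) (x y v : E).

(** Homogeneity is an inequality for positive reals, a form that infima inherit; the inverse scalar
    turns it into an equality. *)
Definition sublinear p :=
  (forall x y, p (x + y) <= p x + p y) /\
  (forall (r : R) x, 0 < r -> p (iota r *: x) <= r * p x).

Lemma sublinearZ p (r : R) x : sublinear p -> 0 <= r -> p (iota r *: x) = r * p x.
Proof.
move=> [_ pZ].
have pZr (s : R) y : 0 < s -> p (iota s *: y) = s * p y.
  move=> s0; apply/eqP; rewrite eq_le pZ //=.
  have := pZ s^-1 (iota s *: y); rewrite invr_gt0 => /(_ s0).
  by rewrite scalerA -rmorphM mulVf ?gt_eqF// rmorph1 scale1r mulrC ler_pdivlMr// mulrC.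
rewrite le_eqVlt => /predU1P[<-|]; last exact: pZr.
rewrite rmorph0 scale0r mul0r.
have := pZr 2 0 (ltr0Sn _ _); rewrite scaler0; lra.
Qed.

Lemma sublinear0 p : sublinear p -> p 0 = 0.
Proof. by move=> ps; rewrite -[0](scale0r 0) -(rmorph0 iota) sublinearZ// mul0r. Qed.

(** The lower bound depends on [p] alone, so it bounds a whole chain of minorants from below at
    once. *)
Lemma sublinear_ge p q x : sublinear q -> (forall y, q y <= p y) -> - p (- x) <= q x.
Proof.
move=> qs qp; rewrite lerNl; apply: le_trans (qp (- x)).
by have := qs.1 x (- x); rewrite subrr sublinear0//; lra.
Qed.

(* Among sublinear functionals the linear ones are the minimal ones: [tilt p v]
   lies below [p], and takes at [- v] the value forced by linearity. *)
Definition tilt p v x : R :=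
  inf [set p (x + iota t *: v) - t * p v | t in [set t : R | 0 <= t]].

Section Tilt.
Variables (p : E -> R) (v : E).
Hypothesis ps : sublinear p.

Let tilt_set x := [set p (x + iota t *: v) - t * p v | t in [set t : R | 0 <= t]].

Let tilt_has_inf x : has_inf (tilt_set x).
Proof.
split; first by exists (p (x + iota 0 *: v) - 0 * p v), 0 => /=.
exists (- p (- x)) => _ [t /= t0 <-].
have := ps.1 (x + iota t *: v) (- x).
by rewrite addrC addKr sublinearZ//; lra.
Qed.

Lemma tilt_le_at (t : R) x : 0 <= t -> tilt p v x <= p (x + iota t *: v) - t * p v.
Proof. by move=> t0; apply: ge_inf; [have [] := tilt_has_inf x|exists t]. Qed.

Lemma le_tilt c x :
  (forall t : R, 0 <= t -> c <= p (x + iota t *: v) - t * p v) -> c <= tilt p v x.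
Proof.
move=> cle; apply: lb_le_inf; first by have [] := tilt_has_inf x.
by move=> _ [t /= t0 <-]; exact: cle.
Qed.

Lemma tilt_le x : tilt p v x <= p x.
Proof. by have := tilt_le_at x (lexx 0); rewrite rmorph0 scale0r addr0 mul0r subr0. Qed.

Lemma tiltN : tilt p v (- v) <= - p v.
Proof.
by have := tilt_le_at (- v) ler01; rewrite rmorph1 scale1r addNr sublinear0// mul1r sub0r.
Qed.

Lemma tilt_sublinear : sublinear (tilt p v).
Proof.
split=> [x y|r x r0].
  rewrite -lerBlDr; apply: le_tilt => t t0; rewrite lerBlDr -lerBlDl.
  apply: le_tilt => s s0; rewrite lerBlDr.
  apply: le_trans (tilt_le_at _ (addr_ge0 t0 s0)) _.
  rewrite rmorphD scalerDl addrACA.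
  have := ps.1 (x + iota t *: v) (y + iota s *: v); lra.
rewrite mulrC -ler_pdivrMr//; apply: le_tilt => t t0.
rewrite ler_pdivrMr//; apply: le_trans (tilt_le_at _ (mulr_ge0 (ltW r0) t0)) _.
by rewrite rmorphM -scalerA -scalerDr sublinearZ ?(ltW r0)//; lra.
Qed.
End Tilt.

(** Zorn's lemma for the reversed pointwise order: a nonempty chain is bounded by its pointwise
    infimum, which is finite by [sublinear_ge]. *)
Lemma exists_minimal_sublinear p : sublinear p ->
  exists q, [/\ sublinear q, forall x, q x <= p x &
    forall q', sublinear q' -> (forall x, q' x <= q x) -> forall x, q x <= q' x].
Proof.
move=> ps; pose T := {q | sublinear q /\ forall x, q x <= p x}.
pose le (q1 q2 : T) := `[< forall x, sval q2 x <= sval q1 x >].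
have [||A Atot|q qmax] := @ZL_preorder T (exist _ p (conj ps (fun x => lexx _))) le.
- by move=> q; apply/asboolP.
- by move=> q1 q2 q3 /asboolP le1 /asboolP le2; apply/asboolP => x; exact: le_trans (le1 x).
- have [[q0 Aq0]|A0] := pselect (exists q0 : T, A q0); last first.
    by exists (exist _ p (conj ps (fun x => lexx _))) => s As; case: A0; exists s.
  pose B x := [set sval q x | q in A].
  have Binf x : has_inf (B x).
    split; first by exists (sval q0 x), q0.
    exists (- p (- x)) => _ [q _ <-]; have [qs qp] := svalP q; exact: sublinear_ge.
  pose q x := inf (B x).
  have qle x (q1 : T) : A q1 -> q x <= sval q1 x.
    by move=> Aq1; apply: ge_inf; [have [] := Binf x|exists q1].
  have q_ge c x : (forall q1 : T, A q1 -> c <= sval q1 x) -> c <= q x.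
    by move=> cle; apply: lb_le_inf; [have [] := Binf x|move=> _ [q1 /cle + <-]].
  have qs : sublinear q.
    split=> [x y|r x r0].
      rewrite -lerBlDr; apply: (q_ge _ _) => q1 Aq1; rewrite lerBlDr -lerBlDl.
      apply: (q_ge _ _) => q2 Aq2; rewrite lerBlDr.
      (* Subadditivity needs one functional at both points: the smaller of [q1] and [q2]. *)
      have [/asboolP q21|/asboolP q12] := Atot _ _ Aq1 Aq2.
        apply: le_trans (qle _ _ Aq2) _; have [[qD _] _] := svalP q2.
        by apply: le_trans (qD _ _) _; rewrite addrC lerD2l.
      apply: le_trans (qle _ _ Aq1) _; have [[qD _] _] := svalP q1.
      by apply: le_trans (qD _ _) _; rewrite addrC lerD2r.
    rewrite mulrC -ler_pdivrMr//; apply: (q_ge _ _) => q1 Aq1.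
    rewrite ler_pdivrMr//; apply: le_trans (qle _ _ Aq1) _.
    by have [[_ qZ] _] := svalP q1; rewrite mulrC; exact: qZ.
  have qp x : q x <= p x by apply: le_trans (qle x _ Aq0) _; have [] := svalP q0.
  by exists (exist _ q (conj qs qp)) => s As; apply/asboolP => x; exact: qle.
- case: q qmax => q [qs qp] qmax; exists q; split=> // q' q's q'q.
  have q'p x : q' x <= p x by apply: le_trans (q'q x) _.
  have /asboolP := qmax (exist _ q' (conj q's q'p)) (introT (asboolP _) q'q).
  by [].
Qed.

(** A minimal [u] below [tilt p v] is below its own tilts, hence odd; an odd subadditive functional
    is additive. The value at [- v] built into [tilt] forces [u v = p v]. *)
Lemma sublinear_support p v : sublinear p ->
  exists u : E -> R, [/\ forall x y, u (x + y) = u x + u y,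
    forall (r : R) x, u (iota r *: x) = r * u x, forall x, u x <= p x & u v = p v].
Proof.
move=> ps; have [u [us up umin]] := exists_minimal_sublinear (tilt_sublinear v ps).
have uN x : u (- x) = - u x.
  have := umin _ (tilt_sublinear x us) (tilt_le x us) (- x).
  have := tiltN x us; have := sublinear_ge x us (fun y => lexx (u y)); lra.
have uD x y : u (x + y) = u x + u y.
  by have := us.1 x y; have := us.1 (- x) (- y); rewrite -opprD !uN; lra.
exists u; split => // [r x|x|].
- have [r0|/ltW r0] := leP 0 r; first exact: sublinearZ.
  apply: oppr_inj; rewrite -uN -scaleNr -rmorphN sublinearZ//; lra.
- exact: le_trans (up x) (tilt_le v ps x).
- apply/le_anti/andP; split; first exact: le_trans (up v) (tilt_le v ps v).
  by have := up (- v); have := tiltN v ps; rewrite uN; lra.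
Qed.

End RealHahnBanach.

(** * Scalars, norms and dual spaces *)

Lemma exists_phase (K : numFieldType) (k : K) : exists a : K, `|a| <= 1 /\ a * k = `|k|.
Proof.
have [->|k0] := eqVneq k 0; first by exists 0; rewrite normr0 mulr0.
exists (`|k| / k); rewrite divfK//; split=> //.
by rewrite normrM normfV normr_id mulfV ?normr_eq0.
Qed.

Section ScalarField.
Variables (R : realType) (K : numFieldType) (nr : K -> R).

(* What the argument uses of the scalar field; it holds for [R] and [R[i]]. *)
Record real_scalars (iota : {rmorphism R -> K}) : Prop := RealScalars {
  iotaK : cancel iota nr;
  nrK : forall k : K, 0 <= k -> iota (nr k) = k;
  iota_ge0 : forall r : R, (0 <= iota r) = (0 <= r);
  hahn_banach : forall (E : lmodType K) (p : E -> R) (v : E),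
    (forall x y, p (x + y) <= p x + p y) ->
    (forall a x, p (a *: x) = nr `|a| * p x) ->
    exists psi : E -> K,
      [/\ forall a x y, psi (a *: x + y) = a * psi x + psi y,
          forall x, nr `|psi x| <= p x & nr `|psi v| = p v];
  bounded_net : forall M d : R, 0 < d -> exists (I : finType) (c : I -> K),
    forall k : K, nr `|k| <= M -> exists i, nr `|k - c i| <= d }.

Variable iota : {rmorphism R -> K}.
Hypothesis rs : real_scalars iota.

Let iotaK := iotaK rs.
Let nrK := nrK rs.
Let iota_ge0 := iota_ge0 rs.

Lemma iota_le (r s : R) : (iota r <= iota s) = (r <= s).
Proof. by rewrite -subr_ge0 -rmorphB iota_ge0 subr_ge0. Qed.

Lemma iota_lt (r s : R) : (iota r < iota s) = (r < s).
Proof. by rewrite !lt_neqAle iota_le (inj_eq (fmorph_inj iota)). Qed.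

Lemma nr0 : nr 0 = 0. Proof. by rewrite -(rmorph0 iota) iotaK. Qed.

Lemma nr1 : nr 1 = 1. Proof. by rewrite -(rmorph1 iota) iotaK. Qed.

Section Norm.
Variable V : normedZmodType K.
Implicit Types x y : V.

Lemma iota_norm x : iota (nr `|x|) = `|x|. Proof. exact/nrK/normr_ge0. Qed.

Lemma nrn_ge0 x : 0 <= nr `|x|. Proof. by rewrite -iota_ge0 iota_norm. Qed.

Lemma nrn_le x (r : R) : (nr `|x| <= r) = (`|x| <= iota r).
Proof. by rewrite -iota_le iota_norm. Qed.

Lemma nrn_lt x (r : R) : (nr `|x| < r) = (`|x| < iota r).
Proof. by rewrite -iota_lt iota_norm. Qed.

Lemma nrn_le1 x : (nr `|x| <= 1) = (`|x| <= 1).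
Proof. by rewrite nrn_le rmorph1. Qed.

Lemma nrn0 : nr `|0 : V| = 0. Proof. by rewrite normr0 nr0. Qed.

Lemma nrn_eq0 x : (nr `|x| == 0) = (x == 0).
Proof. by rewrite -(inj_eq (fmorph_inj iota)) iota_norm rmorph0 normr_eq0. Qed.

Lemma nrnD x y : nr `|x + y| <= nr `|x| + nr `|y|.
Proof. by rewrite nrn_le rmorphD !iota_norm ler_normD. Qed.

Lemma nrnN x : nr `|- x| = nr `|x|. Proof. by rewrite normrN. Qed.

Lemma nrn_sum (I : finType) (F : I -> V) : nr `|\sum_i F i| <= \sum_i nr `|F i|.
Proof.
apply: (big_ind2 (fun x r => nr `|x| <= r)) => // [|x r y s xr ys].
  by rewrite nrn0.
by apply: le_trans (nrnD _ _) _; exact: lerD.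
Qed.

End Norm.

Lemma nrnM (a b : K) : nr `|a * b| = nr `|a| * nr `|b|.
Proof. by apply: (fmorph_inj iota); rewrite rmorphM !iota_norm normrM. Qed.

Lemma nrn_iota (r : R) : 0 <= r -> nr `|iota r| = r.
Proof. by move=> r0; rewrite ger0_norm ?iota_ge0. Qed.

Lemma nrnZ (V : normedModType K) (a : K) (x : V) : nr `|a *: x| = nr `|a| * nr `|x|.
Proof. by apply: (fmorph_inj iota); rewrite rmorphM !iota_norm normrZ. Qed.

Lemma exists_phase_nr (k : K) : exists a : K, nr `|a| <= 1 /\ a * k = iota (nr `|k|).
Proof.
by have [a [a1 ak]] := exists_phase k; exists a; rewrite nrn_le1 iota_norm.
Qed.

Section LinearForms.
Variable X : lmodType K.

Definition linear_form (f : X -> K) :=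
  forall (a : K) (x y : X), f (a *: x + y) = a * f x + f y.

Variable f : X -> K.
Hypothesis fl : linear_form f.

Lemma lfD x y : f (x + y) = f x + f y.
Proof. by have := fl 1 x y; rewrite scale1r mul1r. Qed.

Lemma lf0 : f 0 = 0.
Proof. by apply: (addrI (f 0)); rewrite -lfD !addr0. Qed.

Lemma lfZ a x : f (a *: x) = a * f x.
Proof. by have := fl a x 0; rewrite !addr0 lf0 addr0. Qed.

Lemma lfN x : f (- x) = - f x.
Proof. by rewrite -scaleN1r lfZ mulN1r. Qed.

Lemma lfB x y : f (x - y) = f x - f y.
Proof. by rewrite lfD lfN. Qed.

Lemma lf_sum (I : finType) (F : I -> X) : f (\sum_i F i) = \sum_i f (F i).
Proof. by apply: (big_morph f lfD lf0). Qed.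

End LinearForms.

Lemma linear_form_sum (X : lmodType K) (I : finType) (c : I -> K) (e : I -> X -> K) :
  (forall i, linear_form (e i)) -> linear_form (fun x => \sum_i c i * e i x).
Proof.
move=> el a x y; rewrite mulr_sumr -big_split; apply: eq_bigr => i _ /=.
by rewrite el mulrDr mulrCA.
Qed.

Section DualSpace.
Variable X : normedModType K.
Implicit Types (f g : X -> K) (x y : X).

Lemma bounded_continuous (Y : normedModType K) (T : X -> Y) (M : R) :
  (forall x y, T (x - y) = T x - T y) ->
  (forall x, nr `|T x| <= M * nr `|x|) -> continuous T.
Proof.
move=> TB TM x; apply/cvgrPdist_lt => e e0.
have M0 : 0 < iota (`|M| + 1) by rewrite -(rmorph0 iota) iota_lt ltr_wpDl.
apply/nbhs_normP; exists (e / iota (`|M| + 1)); first exact: divr_gt0.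
move=> y /=; rewrite /ball_ /= ltr_pdivlMr// => xy; rewrite -TB.
apply: le_lt_trans xy; rewrite -(iota_norm (T _)) -(iota_norm (x - y)) -rmorphM iota_le.
apply: le_trans (TM _) _; rewrite mulrC ler_wpM2l ?nrn_ge0//.
by apply: le_trans (ler_norm M) _; rewrite lerDl.
Qed.

Lemma dual_of_bounded f (M : R) : linear_form f ->
  (forall x, nr `|f x| <= M * nr `|x|) -> dual f.
Proof.
move=> fl fM; split => //.
by apply: (@bounded_continuous K^o f M) => // x y; exact: lfB.
Qed.

Lemma dual_bounded f : dual f -> exists M : R, forall x, nr `|f x| <= M * nr `|x|.
Proof.
move=> [fl fc].
have /cvgrPdist_lt/(_ 1 ltr01) := fc 0.
move=> /nbhs_normP[e /= e0]; rewrite /ball_ /= => eb.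
have e0' : 0 < nr e by rewrite -iota_lt rmorph0 nrK// ltW.
exists (2 / nr e) => x.
have [->|x0] := eqVneq x 0; first by rewrite (lf0 fl) !nrn0 mulr0.
have nx0 : 0 < nr `|x| by rewrite lt_neqAle eq_sym nrn_eq0 x0 nrn_ge0.
(* Scaling by [r] brings [x] to half the radius on which [f] stays below 1 in modulus; hence the
   constant [2 / nr e]. *)
set r := nr e / (2 * nr `|x|).
have r0 : 0 < r by rewrite divr_gt0// mulr_gt0.
have key y : nr `|y| < nr e -> nr `|f y| < 1.
  rewrite !nrn_lt (nrK (ltW e0)) rmorph1 => ye.
  by have := eb y; rewrite /= (lf0 fl) !sub0r !normrN; exact.
have := key (iota r *: x); rewrite nrnZ (lfZ fl) nrnM !(nrn_iota (ltW r0)).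
have rx : r * nr `|x| = nr e / 2 by rewrite /r; field; rewrite gt_eqF.
rewrite rx ltr_pdivrMr// ltr_pMr// ltr1n => /(_ isT) /ltW frx.
rewrite mulrAC ler_pdivlMr//; rewrite /r in frx.
have := ler_wpM2r (ltW (mulr_gt0 (@ltr0Sn R 1) nx0)) frx.
by rewrite mul1r mulrAC divfK ?gt_eqF ?mulr_gt0// mulrC.
Qed.

Lemma dnorm_has_sup f : dual f ->
  has_sup [set nr `|f x| | x in [set x : X | `|x| <= 1]].
Proof.
move=> fd; have [M fM] := dual_bounded fd; split.
  by exists (nr `|f 0|), 0 => //=; rewrite normr0.
exists `|M| => _ [x /= x1 <-]; apply: le_trans (fM x) _.
apply: le_trans (ler_norm _) _; rewrite normrM -[leRHS]mulr1 ler_wpM2l//.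
by rewrite ger0_norm ?nrn_ge0// nrn_le1.
Qed.

Lemma dnorm_ub f x : dual f -> `|x| <= 1 -> nr `|f x| <= dnorm nr f.
Proof. by move=> /dnorm_has_sup[_ fs] x1; apply: ub_le_sup => //; exists x. Qed.

Lemma dnorm_le f (c : R) : (forall x, `|x| <= 1 -> nr `|f x| <= c) -> dnorm nr f <= c.
Proof.
move=> fc; apply: ge_sup; first by exists (nr `|f 0|), 0 => //=; rewrite normr0.
by move=> _ [x /= x1 <-]; exact: fc.
Qed.

Lemma dnorm_nneg f : dual f -> 0 <= dnorm nr f.
Proof.
by move=> fd; apply: le_trans (dnorm_ub fd (x := 0) _); rewrite ?nrn_ge0 ?normr0.
Qed.

Lemma dnormP f x : dual f -> nr `|f x| <= dnorm nr f * nr `|x|.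
Proof.
move=> fd; have [fl _] := fd.
have [->|x0] := eqVneq x 0; first by rewrite (lf0 fl) !nrn0 mulr0.
have nx0 : 0 < nr `|x| by rewrite lt_neqAle eq_sym nrn_eq0 x0 nrn_ge0.
have i0 : 0 <= (nr `|x|)^-1 by rewrite invr_ge0 ltW.
have := @dnorm_ub f (iota (nr `|x|)^-1 *: x) fd.
rewrite -nrn_le1 nrnZ nrn_iota// mulVf ?gt_eqF// => /(_ (lexx _)).
by rewrite (lfZ fl) nrnM nrn_iota// ler_pdivrMl// mulrC.
Qed.

Lemma dual0 : dual (fun _ : X => 0 : K).
Proof.
apply: (@dual_of_bounded _ 0) => [a x y|x]; first by rewrite mulr0 addr0.
by rewrite nrn0 mul0r.
Qed.

Lemma dualP a f g : dual f -> dual g -> dual (fun x => a * f x + g x).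
Proof.
move=> fd gd; apply: (@dual_of_bounded _ (nr `|a| * dnorm nr f + dnorm nr g)).
  by move=> b x y; rewrite fd.1 gd.1; ring.
move=> x; apply: le_trans (nrnD _ _) _; rewrite mulrDl lerD ?dnormP// nrnM -mulrA.
by rewrite ler_wpM2l ?nrn_ge0 ?dnormP.
Qed.

Lemma dual_sum (I : finType) (c : I -> K) (e : I -> X -> K) :
  (forall i, dual (e i)) -> dual (fun x => \sum_i c i * e i x).
Proof.
move=> ed; apply: (@dual_of_bounded _ (\sum_i nr `|c i| * dnorm nr (e i))).
  by apply: linear_form_sum => i; case: (ed i).
move=> x; apply: le_trans (nrn_sum _) _; rewrite mulr_suml ler_sum// => i _.
by rewrite nrnM -mulrA ler_wpM2l ?nrn_ge0 ?dnormP.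
Qed.

(** Linearity is asked on the dual only: members of [bidual] and the maps [g |-> S g u] are
    specified nowhere else. *)
Definition dual_linear (L : (X -> K) -> K) :=
  forall a g h, dual g -> dual h -> L (fun x => a * g x + h x) = a * L g + L h.

Lemma dual_linear0 L : dual_linear L -> L (fun _ => 0) = 0.
Proof.
move=> Ll; apply: (addrI (L (fun _ => 0))); rewrite addr0.
rewrite -[X in X + _]mul1r -(Ll 1 _ _ dual0 dual0).
by congr L; apply/funext => x; rewrite mulr0 addr0.
Qed.

Lemma dual_linear_sum (I : finType) (c : I -> K) (e : I -> X -> K) L :
  dual_linear L -> (forall i, dual (e i)) ->
  L (fun x => \sum_i c i * e i x) = \sum_i c i * L (e i).
Proof.
move=> Ll ed.
(* The induction carries membership of the partial sums in the dual, since [L] is known to be linear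
   only there. *)
suff [] : dual (fun x => \sum_(i <- index_enum I) c i * e i x) /\
  L (fun x => \sum_(i <- index_enum I) c i * e i x) =
  \sum_(i <- index_enum I) c i * L (e i) by [].
elim: (index_enum I) => [|i r [dr IH]].
  rewrite big_nil; under eq_fun do rewrite big_nil.
  by split; [exact: dual0|exact: dual_linear0].
under eq_fun do rewrite big_cons.
by split; [exact: dualP|rewrite big_cons Ll// IH].
Qed.

End DualSpace.

End ScalarField.

(** * Biorthogonal systems *)

(** A biorthogonal system in [G] that does not expand all of [G] can be enlarged by one pair, while
    more than [n] pairs would exceed the rank that [n] spanning functions allow. As [X] is a bare
    type, restrictions of functionals to a subspace are covered too. *)
Lemma biorthogonal_basis (X : Type) (K : fieldType) (G : set (X -> K))
    (n : nat) (e : 'I_n -> X -> K) :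
  G (fun _ => 0) ->
  (forall a g h, G g -> G h -> G (fun x => a * g x + h x)) ->
  (forall g, G g -> exists c : 'I_n -> K, g = (fun x => \sum_i c i * e i x)) ->
  exists (m : nat) (x : 'I_m -> X) (f : 'I_m -> X -> K),
    [/\ forall i, G (f i), forall i j, f i (x j) = (i == j)%:R
      & forall g, G g -> g = (fun y => \sum_i g (x i) * f i y)].
Proof.
move=> G0 GP Ge.
pose P m := exists (x : 'I_m -> X) (f : 'I_m -> X -> K),
  (forall i, G (f i)) /\ (forall i j, f i (x j) = (i == j)%:R).
apply: contrapT => nobasis.
have Gsum m (c : 'I_m -> K) (f : 'I_m -> X -> K) :
    (forall i, G (f i)) -> G (fun x => \sum_i c i * f i x).
  elim: m c f => [|m IH] c f Gf.
    by under eq_fun do rewrite big_ord0.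
  by under eq_fun do rewrite big_ord_recl; apply: GP => //; exact: IH.
have Pn m : P m.
  elim: m => [|m [x [f [Gf fx]]]].
    by exists (fun i : 'I_0 => False_rect X (notF (ltn_ord i))),
              (fun _ _ => 0); split=> -[].
  have [g [Gg]] : exists g, G g /\ g <> (fun y => \sum_i g (x i) * f i y).
    apply: contrapT => /forallNP none; apply: nobasis; exists m, x, f; split=> // g Gg.
    by apply: contrapT => gN; apply: (none g).
  (* Removing the expansion of [g] leaves a nonzero member of [G] that vanishes at every [x j]; a
     point [y] where it is nonzero joins the system. *)
  pose g' y := (-1) * (\sum_i g (x i) * f i y) + g y.
  move=> gN; have [y g'y] : exists y, g' y != 0.
    apply: contrapT => /forallNP g'0; apply: gN; apply/funext => y.
    by have /negP/negPn := g'0 y; rewrite /g' mulN1r addrC subr_eq0 => /eqP.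
  have Gg' : G g' by apply: GP => //; exact: Gsum.
  have g'x j : g' (x j) = 0.
    rewrite /g' (bigD1 j)//= fx eqxx mulr1 big1 ?addr0 ?mulN1r ?addNr// => i ij.
    by rewrite fx (negbTE ij) mulr0.
  pose u z := (g' y)^-1 * g' z.
  have Gu : G u.
    by have := GP (g' y)^-1 _ _ Gg' G0; under eq_fun do rewrite addr0.
  have uy : u y = 1 by rewrite /u mulVf.
  have ux j : u (x j) = 0 by rewrite /u g'x mulr0.
  (* The new pair stands at index 0, and a multiple of [u] is removed from each old [f j] to make it
     vanish at [y]. *)
  exists (fun i => oapp x y (unlift ord0 i)),
    (fun i z => oapp (fun j => - f j y * u z + f j z) (u z) (unlift ord0 i)).
  split=> [i|i j].
    case: unliftP => [j _|_] //=; exact: GP.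
  case: (unliftP ord0 i) => [i' ->|->]; case: (unliftP ord0 j) => [j' ->|->] /=.
  - by rewrite ux mulr0 add0r fx (inj_eq lift_inj).
  - by rewrite uy mulr1 addNr.
  - by rewrite ux.
  - by rewrite uy.
have [x [f [Gf fx]]] := Pn n.+1.
have /choice[c cE] i := Ge _ (Gf i).
have : \matrix_(i < n.+1, k < n) c i k *m \matrix_(k < n, j < n.+1) e k (x j) =
    1%:M :> 'M[K]_n.+1.
  apply/matrixP => i j; rewrite !mxE -fx cE; apply: eq_bigr => k _.
  by rewrite !mxE.
move/(congr1 mxrank); rewrite mxrank1 => /eqP; apply/negP.
rewrite neq_ltn ltnS; apply/orP; left.
exact: leq_trans (mxrankM_maxl _ _) (rank_leq_col _).
Qed.

(** * Gauges, separation from subspaces, realization on finitely many functionals *)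

Section Helly.
Variables (R : realType) (K : numFieldType) (nr : K -> R) (iota : {rmorphism R -> K}).
Hypothesis rs : real_scalars nr iota.

Let nge0 := nrn_ge0 rs.

(** Here [G x r] reads as: the gauge of [x] is at most [r]. The infimum of such [r] is a seminorm,
    supported at [v] by Hahn-Banach; the relational form gives quotient seminorms without forming
    quotients. *)
Lemma gauge_functional (E : lmodType K) (G : E -> R -> Prop) (v : E) :
  (forall x r, G x r -> 0 <= r) -> (forall x, exists r, G x r) ->
  (forall x y r s, G x r -> G y s -> G (x + y) (r + s)) ->
  (forall a x r, G x r -> G (a *: x) (nr `|a| * r)) ->
  exists psi : E -> K, [/\ linear_form psi, forall x r, G x r -> nr `|psi x| <= r
    & forall d, (forall r, G v r -> d <= r) -> d <= nr `|psi v|].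
Proof.
move=> G0 Gex GD GZ; pose p x := inf [set r | G x r].
have pinf x : has_inf [set r | G x r].
  by split; [exact: Gex|exists 0 => r /= /G0].
have ple x r : G x r -> p x <= r.
  by move=> Gxr; apply: ge_inf; [have [] := pinf x|].
have lep x c : (forall r, G x r -> c <= r) -> c <= p x.
  by move=> cle; apply: lb_le_inf; [have [] := pinf x|].
have pge0 x : 0 <= p x by apply: (lep _ _) => r /G0.
have pD x y : p (x + y) <= p x + p y.
  rewrite -lerBlDr; apply: (lep _ _) => r Gr; rewrite lerBlDr -lerBlDl.
  apply: (lep _ _) => s Gs; rewrite lerBlDr addrC.
  by apply: (ple _ _); exact: GD.
have pZle a x : p (a *: x) <= nr `|a| * p x.
  have [->|a0] := eqVneq a 0.
    have [r Gr] := Gex x; have := ple _ _ (GZ 0 _ _ Gr).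
    by rewrite (nrn0 rs) !mul0r.
  have na0 : 0 < nr `|a| by rewrite lt_neqAle eq_sym (nrn_eq0 rs) a0 nge0.
  rewrite mulrC -ler_pdivrMr//; apply: (lep _ _) => r Gr.
  by rewrite ler_pdivrMr// mulrC; apply: (ple _ _); exact: GZ.
have pZ a x : p (a *: x) = nr `|a| * p x.
  apply/le_anti; rewrite pZle/=.
  have [->|a0] := eqVneq a 0; first by rewrite (nrn0 rs) mul0r.
  have := ler_wpM2l (nge0 a) (pZle a^-1 (a *: x)).
  by rewrite scalerA mulVf// scale1r mulrA -(nrnM rs) divff// normr1 (nr1 rs) mul1r.
have [psi [psil psip psiv]] := hahn_banach rs v pD pZ.
exists psi; split=> // [x r Gxr|d dle]; first exact: le_trans (psip x) (ple _ _ Gxr).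
by rewrite psiv; exact: lep.
Qed.

Section Separation.
Variable Y : normedModType K.

Definition lin_subspace (V : set Y) :=
  V 0 /\ forall (a : K) x y, V x -> V y -> V (a *: x + y).

Lemma lin_subspaceD V x y : lin_subspace V -> V x -> V y -> V (x + y).
Proof. by move=> [_ VP] Vx Vy; have := VP 1 _ _ Vx Vy; rewrite scale1r. Qed.

Lemma lin_subspaceZ V a x : lin_subspace V -> V x -> V (a *: x).
Proof. by move=> [V0 VP] Vx; have := VP a _ _ Vx V0; rewrite addr0. Qed.

Lemma lin_subspace_sum V (I : finType) (F : I -> Y) :
  lin_subspace V -> (forall i, V (F i)) -> V (\sum_i F i).
Proof.
move=> Vs VF; apply: (big_ind V) => [|x y|//]; first by case: Vs.
exact: lin_subspaceD.
Qed.

(** The gauge is the distance to [V], positive at a point outside the closed [V]; the supporting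
    functional vanishes on [V]. *)
Lemma annih_separates (V : set Y) y : closed_subspace V ->
  (forall g, annih V g -> g y = 0) -> V y.
Proof.
move=> [Vc V0 VP] Vy; apply: contrapT => nVy.
have [e e0 ye] : exists2 e : R, 0 < e & forall v, V v -> e <= nr `|y + v|.
  have := closed_openC Vc; rewrite openE => /(_ y nVy).
  move=> /nbhs_normP[e /= e0 eb]; exists (nr e).
    by rewrite -(iota_lt rs) rmorph0 (nrK rs) // ltW.
  move=> v Vv; rewrite leNgt; apply/negP; rewrite (nrn_lt rs) (nrK rs) ?ltW// => yv.
  apply: (eb (- v)); first by rewrite /= opprK.
  by have := VP (-1) _ _ Vv V0; rewrite addr0 scaleN1r.
pose G (x : Y) (r : R) := exists2 v, V v & nr `|x + v| <= r.
have [||||psi [psil psiG psiy]] := @gauge_functional Y G y.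
- by move=> x r [v _]; apply: le_trans; exact: nge0.
- by move=> x; exists (nr `|x + 0|), 0.
- move=> x1 x2 r1 r2 [v1 V1 h1] [v2 V2 h2]; exists (v1 + v2).
    by have := VP 1 _ _ V1 V2; rewrite scale1r.
  by rewrite addrACA; apply: le_trans (nrnD rs _ _) _; exact: lerD.
- move=> a x r [v Vv h]; exists (a *: v).
    by have := VP a _ _ Vv V0; rewrite addr0.
  by rewrite -scalerDr (nrnZ rs) ler_wpM2l// nge0.
have psiV : annih V psi.
  split.
    apply: (dual_of_bounded rs (M := 1)) => // x; rewrite mul1r; apply: psiG.
    by exists 0; rewrite ?addr0.
  move=> v Vv; apply/eqP; rewrite -(nrn_eq0 rs) eq_le nge0 andbT.
  apply: psiG; exists ((-1) *: v + 0); first exact: VP.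
  by rewrite addr0 scaleN1r subrr (nrn0 rs).
have : e <= nr `|psi y| by apply: psiy => r [v /ye h1 h2]; exact: le_trans h2.
by rewrite Vy// (nrn0 rs) leNgt e0.
Qed.

Lemma realize_on_finite (V : set Y) (q : nat) (phi : 'I_q -> Y -> K)
    (w : (Y -> K) -> K) :
  lin_subspace V -> (forall p, dual (phi p)) -> dual_linear w ->
  (forall g, annih V g -> w g = 0) ->
  exists w0, [/\ V w0, forall p, phi p w0 = w (phi p) &
    forall theta, dual theta ->
      (forall v, V v -> (forall p, phi p v = 0) -> theta v = 0) ->
      w theta = theta w0].
Proof.
move=> Vs phid wl wV.
pose G : set ({y | V y} -> K) := [set k | exists c : 'I_q -> K,
  k = fun y => \sum_p c p * phi p (sval y)].
have [|||m [x [f [Gf _ Gb]]]] := @biorthogonal_basis _ K G q (fun p y => phi p (sval y)).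
- by exists (fun _ => 0); apply/funext => y; rewrite big1// => p _; rewrite mul0r.
- move=> a _ _ [c ->] [d ->]; exists (fun p => a * c p + d p); apply/funext => y.
  by rewrite mulr_sumr -big_split; apply: eq_bigr => p _ /=; rewrite mulrDl mulrA.
- by move=> g [c ->]; exists c.
have /choice[c cE] i := Gf i.
pose F i y := \sum_p c i p * phi p y; pose v i := sval (x i).
have Fd i : dual (F i) by exact: (dual_sum rs).
have Vv i : V (v i) by exact: svalP.
have phiE p y : V y -> phi p y = \sum_i phi p (v i) * F i y.
  move=> Vy; have /Gb : G (fun y => phi p (sval y)).
    exists (fun p' => (p == p')%:R); apply/funext => z.
    rewrite (bigD1 p)//= eqxx mul1r big1 ?addr0// => p' pp'.
    by rewrite eq_sym (negbTE pp') mul0r.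
  move=> /(congr1 (fun k => k (exist _ y Vy))) /= ->.
  by apply: eq_bigr => i _; rewrite cE.
have w_ext g h : dual g -> dual h -> (forall y, V y -> g y = h y) -> w g = w h.
  move=> gd hd gh; have : w (fun y => (-1) * g y + h y) = 0.
    apply: wV; split; first exact: (dualP rs).
    by move=> y Vy; rewrite gh// mulN1r addNr.
  by rewrite wl// mulN1r addrC => /eqP; rewrite subr_eq0 => /eqP.
have phi_w0 g : dual g -> g (\sum_i w (F i) *: v i) = \sum_i g (v i) * w (F i).
  move=> [gl _]; rewrite (lf_sum gl); apply: eq_bigr => i _.
  by rewrite (lfZ gl) mulrC.
exists (\sum_i w (F i) *: v i); split.
- by apply: lin_subspace_sum => // i; exact: lin_subspaceZ.
- move=> p; rewrite phi_w0// -(dual_linear_sum rs)//; apply: w_ext => //.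
    exact: (dual_sum rs).
  by move=> y Vy; rewrite -phiE.
- move=> theta thd thV; rewrite phi_w0// -(dual_linear_sum rs)//; apply: w_ext => //.
    exact: (dual_sum rs).
  move=> y Vy; have [tl _] := thd; apply/eqP; rewrite -subr_eq0.
  have -> : \sum_i theta (v i) * F i y = theta (\sum_i F i y *: v i).
    by rewrite (lf_sum tl); apply: eq_bigr => i _; rewrite (lfZ tl) mulrC.
  rewrite -(lfB tl); apply/eqP/thV.
    rewrite addrC -scaleN1r; apply: Vs.2 => //.
    by apply: lin_subspace_sum => // i; exact: lin_subspaceZ.
  move=> p; have [pl _] := phid p; rewrite (lfB pl) (lf_sum pl) phiE//.
  apply/eqP; rewrite subr_eq0; apply/eqP; apply: eq_bigr => i _.
  by rewrite (lfZ pl) mulrC.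
Qed.

End Separation.
End Helly.

(** * Helly's theorem *)

Section LocalReflexivity.
Variables (R : realType) (K : numFieldType) (nr : K -> R) (iota : {rmorphism R -> K}).
Hypothesis rs : real_scalars nr iota.
Variable Y : normedModType K.

Let nge0 := nrn_ge0 rs.

Section SupNormDual.
Variables (I : finType) (psi : (I -> Y) -> K).
Hypothesis psil : linear_form psi.
Hypothesis psi1 : forall (y : I -> Y) (r : R),
  0 <= r -> (forall i, nr `|y i| <= r) -> nr `|psi y| <= r.

Definition single (i : I) (y : Y) : I -> Y := fun i' => if i' == i then y else 0.

Lemma sum_single (y : I -> Y) : y = \sum_i single i (y i).
Proof.
apply/funext => i; rewrite fct_sumE (bigD1 i)//= /single eqxx big1 ?addr0// => i'.
by rewrite eq_sym => /negbTE ->.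
Qed.

Lemma coordinates (y : I -> Y) : psi y = \sum_i psi (single i (y i)).
Proof. by rewrite {1}(sum_single y) (lf_sum psil). Qed.

Lemma coordinate_dual i : dual (fun y => psi (single i y)).
Proof.
apply: (dual_of_bounded rs (M := 1)) => [a x y|x].
  rewrite -psil; congr psi; apply/funext => i'; rewrite /single /=.
  by rewrite -[RHS]/(a *: (if _ then _ else _) + _); case: eqP; rewrite // scaler0 addr0.
rewrite mul1r; apply: psi1 => [|i']; first exact: nge0.
by rewrite /single; case: eqP => // _; rewrite (nrn0 rs) nge0.
Qed.

(** The dual of a sup-norm power carries the sum of the norms: near-norming vectors, rotated by
    phases, form one point of the unit ball where [psi] nearly attains that sum. *)
Lemma sum_dnorm_le1 : \sum_i dnorm nr (fun y => psi (single i y)) <= 1.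
Proof.
apply/ler_addgt0Pr => e e0.
have c0 : 0 < #|I|.+1%:R :> R by rewrite ltr0n.
(* There are [#|I|] errors of size [d]; the successor keeps the denominator positive when [I] is
   empty. *)
pose d := e / #|I|.+1%:R; have d0 : 0 < d by exact: divr_gt0.
have /choice[y yP] i : exists y : Y, `|y| <= 1 /\
    dnorm nr (fun y => psi (single i y)) <= nr `|psi (single i y)| + d.
  have [_ [y /= y1 <-] h] := sup_adherent d0 (dnorm_has_sup rs (coordinate_dual i)).
  by exists y; split=> //; rewrite -lerBlDr ltW.
have /choice[a aP] i := exists_phase_nr rs (psi (single i (y i))).
apply: (@le_trans _ _ (\sum_i (nr `|psi (single i (y i))| + d))).
  by apply: ler_sum => i _; have [_] := yP i.
rewrite big_split sumr_const /=; apply: lerD; last first.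
  rewrite -mulr_natl /d mulrA ler_pdivrMr// mulrC ler_wpM2l// ?(ltW e0)//.
  by rewrite ler_nat leqnSn.
have s0 : 0 <= \sum_i nr `|psi (single i (y i))| by apply: sumr_ge0 => i _; exact: nge0.
rewrite -(nrn_iota rs s0) rmorph_sum /=.
have -> : \sum_i iota (nr `|psi (single i (y i))|) = psi (fun i => a i *: y i).
  rewrite coordinates; apply: eq_bigr => i _; have [_ <-] := aP i.
  rewrite -(lfZ psil); congr psi; apply/funext => i'; rewrite /single.
  by rewrite -[LHS]/(a i *: (if _ then _ else _)); case: eqP; rewrite ?scaler0.
apply: psi1 => // i; rewrite (nrnZ rs); have [y1 _] := yP i; have [a1 _] := aP i.
by rewrite -[leRHS]mul1r ler_pM// ?nge0// (nrn_le1 rs).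
Qed.

End SupNormDual.

(* Helly's condition: if [b] and the [w j], seen in the bidual, satisfy the norm
   bounds, then Hahn-Banach on the sup-norm space [I -> Y] modulo the admissible
   perturbations yields vectors of [Y] with almost the same bounds. *)
Lemma helly (I J : finType) (V : J -> set Y) (q : nat) (phi : 'I_q -> Y -> K)
    (w : J -> (Y -> K) -> K) (b : I -> Y) (lam : I -> J -> K) (s e : R) :
  (forall j, lin_subspace (V j)) -> (forall p, dual (phi p)) ->
  (forall j, dual_linear (w j)) ->
  (forall j g, annih (V j) g -> w j g = 0) ->
  0 <= s -> 0 < e ->
  (forall i g, dual g -> nr `|g (b i) + \sum_j lam i j * w j g| <= s * dnorm nr g) ->
  exists v : J -> Y, [/\ forall j, V j (v j), forall j p, phi p (v j) = w j (phi p)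
    & forall i, nr `|b i + \sum_j lam i j *: v j| <= s + e].
Proof.
move=> Vs phid wl wV s0 e0 bound.
(* [v0] meets the exact constraints without a norm bound; the families in [M] are the perturbations
   that preserve them. *)
have /choice[v0 v0P] j := realize_on_finite rs (Vs j) phid (wl j) (wV j).
pose M (m : J -> Y) := forall j, V j (m j) /\ forall p, phi p (m j) = 0.
pose act (m : J -> Y) i := \sum_j lam i j *: m j.
have M0 : M (fun _ => 0).
  by move=> j; split=> [|p]; [case: (Vs j)|rewrite (lf0 (phid p).1)].
have MP a m m' : M m -> M m' -> M (fun j => a *: m j + m' j).
  move=> Mm Mm' j; have [Vm pm] := Mm j; have [Vm' pm'] := Mm' j.
  split=> [|p]; first by apply: (Vs j).2.
  by rewrite (phid p).1 pm pm' mulr0 addr0.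
have actP a m m' i : act (fun j => a *: m j + m' j) i = a *: act m i + act m' i.
  rewrite /act scaler_sumr -big_split; apply: eq_bigr => j _ /=.
  by rewrite scalerDr !scalerA mulrC.
have act0 i : act (fun _ => 0) i = 0.
  by rewrite /act big1// => j _; rewrite scaler0.
pose G (y : I -> Y) (r : R) :=
  0 <= r /\ exists2 m, M m & forall i, nr `|y i + act m i| <= r.
apply: contrapT => none.
pose y0 : I -> Y := fun i => b i + act v0 i.
have [||||psi [psil psiG psiy]] := @gauge_functional _ _ _ _ rs (I -> Y) G y0.
- by move=> y r [].
- move=> y; exists (\sum_i nr `|y i|); split; first by apply: sumr_ge0 => i _; exact: nge0.
  exists (fun _ => 0) => // i; rewrite act0 addr0 (bigD1 i)//= lerDl.
  by apply: sumr_ge0 => i' _; exact: nge0.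
- move=> y1 y2 r1 r2 [r10 [m1 M1 h1]] [r20 [m2 M2 h2]]; split; first exact: addr_ge0.
  exists (fun j => 1 *: m1 j + m2 j) => [|i]; first exact: MP.
  rewrite actP scale1r -[(y1 + y2) i]/(y1 i + y2 i) addrACA.
  by apply: le_trans (nrnD rs _ _) _; exact: lerD.
- move=> a y r [r0 [m Mm h]]; split; first by rewrite mulr_ge0 ?nge0.
  exists (fun j => a *: m j + 0) => [|i]; first exact: MP.
  rewrite actP act0 addr0 -[(a *: y) i]/(a *: y i) -scalerDr (nrnZ rs).
  by rewrite ler_wpM2l ?nge0.
have psi1 (y : I -> Y) r : 0 <= r -> (forall i, nr `|y i| <= r) -> nr `|psi y| <= r.
  by move=> r0 yr; apply: psiG; split=> //; exists (fun _ => 0) => // i; rewrite act0 addr0.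
pose psi_ i y := psi (single i y).
have psid i : dual (psi_ i) by exact: coordinate_dual.
pose theta j y := \sum_i lam i j * psi_ i y.
have thd j : dual (theta j) by exact: (dual_sum rs).
have thE j y : theta j y = psi (fun i => lam i j *: y).
  rewrite (coordinates psil); apply: eq_bigr => i _.
  by rewrite -[RHS]/(psi_ i _) (lfZ (psid i).1).
(* Perturbations of the [j]-th vector have gauge 0, so [theta j] kills them, and its value under
   [w j] is its value at [v0 j]. *)
have wth j : w j (theta j) = theta j (v0 j).
  have [_ _] := v0P j; apply=> // v Vv pv; rewrite thE.
  apply/eqP; rewrite -(nrn_eq0 rs) eq_le nge0 andbT; apply: psiG; split=> //.
  exists (fun j' => (-1) *: (if j' == j then v else 0) + 0).
    apply: MP => // j'; case: eqP => [->|_]; first by [].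
    exact: M0.
  move=> i; rewrite actP act0 addr0 scaleN1r /act (bigD1 j)//= eqxx big1 ?addr0.
    by rewrite subrr (nrn0 rs).
  by move=> j' /negbTE ->; rewrite scaler0.
have psiy0 : psi y0 = \sum_i (psi_ i (b i) + \sum_j lam i j * w j (psi_ i)).
  have -> : y0 = b + \sum_j (fun i => lam i j *: v0 j).
    by apply/funext => i; rewrite fct_sumE.
  rewrite (lfD psil) (coordinates psil b) big_split /=; congr (_ + _).
  rewrite (lf_sum psil) exchange_big; apply: eq_bigr => j _ /=.
  by rewrite -thE -wth (dual_linear_sum rs).
have : nr `|psi y0| <= s.
  rewrite psiy0; apply: le_trans (nrn_sum rs _) _.
  apply: (@le_trans _ _ (\sum_i s * dnorm nr (psi_ i))).
    by apply: ler_sum => i _; exact: bound.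
  by rewrite -mulr_sumr -[leRHS]mulr1 ler_wpM2l// sum_dnorm_le1.
(* If no family met the bound, every [r] admissible for [y0] would be at least [s + e], and so would
   the modulus of [psi y0]. *)
apply/negP; rewrite -ltNge; apply: (@lt_le_trans _ _ (s + e)); first by rewrite ltrDl.
apply: psiy => r [r0 [m Mm h]]; rewrite leNgt; apply/negP => rse; apply: none.
exists (fun j => 1 *: m j + v0 j); split=> [j|j p|i].
- by apply: (Vs j).2; [case: (Mm j)|case: (v0P j)].
- by rewrite (phid p).1 (Mm j).2 mulr0 add0r; case: (v0P j).
- rewrite -[\sum_j _]/(act _ i) actP scale1r (addrC (act m i)) addrA.
  exact: le_trans (h i) (ltW rse).
Qed.

End LocalReflexivity.

(** * Row spaces and adapted splittings *)

Section RowSpaces.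
Variables (K : fieldType) (n : nat).

(** If no matrix worked, one with row space inside [Z] could always absorb a further row of [Z], and
    its rank would exceed [n]. *)
Lemma row_space_of_set (Z : set 'rV[K]_n) :
  Z 0 -> (forall a y z, Z y -> Z z -> Z (a *: y + z)) ->
  exists M : 'M[K]_n, forall z, Z z <-> (z <= M)%MS.
Proof.
move=> Z0 ZP; apply: contrapT => none.
have step r : exists M : 'M[K]_n, (forall z, (z <= M)%MS -> Z z) /\ (r <= \rank M)%N.
  elim: r => [|r [M [MZ rM]]].
    by exists 0; split=> // z /submx0null ->.
  have [z [Zz zM]] : exists z, Z z /\ ~~ (z <= M)%MS.
    apply: contrapT => noz; apply: none; exists M => z; split; last exact: MZ.
    by move=> Zz; apply: contrapT => /negP zM; apply: noz; exists z.
  exists (M + z)%MS; split.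
    move=> y /sub_addsmxP[[u1 u2] /= ->].
    rewrite [u2]mx11_scalar mul_scalar_mx addrC; apply: ZP => //.
    exact/MZ/submxMl.
  apply: leq_ltn_trans rM _; suff: (M < M + z)%MS by rewrite ltmxErank => /andP[].
  rewrite /ltmx addsmxSl/=; apply: contra zM; exact: submx_trans (addsmxSr _ _).
have [M [_]] := step n.+1; rewrite leqNgt ltnS rank_leq_col //.
Qed.

(* [A] and [B] generate a distributive lattice, so one splitting of the whole
   space is adapted to both. *)
Lemma adapted_splitting (A B : 'M[K]_n) : exists Q P1 P3 : 'M[K]_n,
  [/\ Q + P1 + P3 = 1%:M, (Q <= A)%MS /\ (P1 <= B)%MS,
      A *m P1 = 0 /\ A *m P3 = 0, B *m P3 = 0 /\ (B *m Q <= B)%MS & P1 *m P1 = P1].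
Proof.
(* [D] is a complement in [B] of the intersection with [A], so [A + B] is the direct sum of [A] and
   [D]; [Q], [P1] and [P3] project on [A], [D] and a complement of that sum. *)
set D := (B :\: A)%MS; set S := (A + D)%MS; pose Pi := proj_mx S S^C%MS.
have DA : (D :&: A = 0)%MS by exact: capmx_diff.
have AD : (A :&: D = 0)%MS by rewrite capmxC.
have SC : (S :&: S^C = 0)%MS by exact: capmx_compl.
have AS : (A <= S)%MS by exact: addsmxSl.
have DS : (D <= S)%MS by exact: addsmxSr.
have DB : (D <= B)%MS by exact: diffmxSl.
have BS : (B <= S)%MS.
  rewrite -(addsmx_diff_cap_eq B A) addsmx_sub DS /=.
  exact: submx_trans (capmxSr _ _) AS.
have PiS : (Pi <= S)%MS by rewrite -[Pi]mul1mx proj_mx_sub.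
have PiE (W : 'M[K]_n) : (W <= S)%MS -> W *m Pi = W by exact: proj_mx_id.
have BP1 : B *m (Pi *m proj_mx D A) = B *m proj_mx D A by rewrite mulmxA PiE.
have sumPi : Pi *m proj_mx A D + Pi *m proj_mx D A = Pi by exact: add_proj_mx.
have P1D : (Pi *m proj_mx D A <= D)%MS by exact: proj_mx_sub.
exists (Pi *m proj_mx A D), (Pi *m proj_mx D A), (1%:M - Pi); split.
- by rewrite sumPi addrC subrK.
- by split; [exact: proj_mx_sub|exact: submx_trans P1D DB].
- split; first by rewrite mulmxA PiE// proj_mx_0.
  by rewrite mulmxBr mulmx1 PiE// subrr.
- split; first by rewrite mulmxBr mulmx1 PiE// subrr.
  (* On [B], [Q] is the identity minus [P1], and both map [B] into itself. *)
  have -> : Pi *m proj_mx A D = Pi - Pi *m proj_mx D A by rewrite -{2}sumPi addrK.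
  rewrite mulmxBr PiE// addmx_sub// eqmx_opp BP1.
  exact: submx_trans (proj_mx_sub _ _ _) DB.
- have P1S := submx_trans P1D DS.
  by rewrite mulmxA (PiE _ P1S) proj_mx_id.
Qed.

End RowSpaces.

(** * Approximation of finite-rank operators on the dual *)

Section FiniteRank.
Variables (R : realType) (K : numFieldType) (nr : K -> R) (iota : {rmorphism R -> K}).
Hypothesis rs : real_scalars nr iota.
Variables (X Y : normedModType K) (U : set X) (V : set Y).
Variable S : (Y -> K) -> (X -> K).
Hypotheses (Us : closed_subspace U) (Vs : closed_subspace V).
Hypothesis Sop : dual_fin_rank_op nr S.

Let nge0 := nrn_ge0 rs.

Lemma op_dual g : dual g -> dual (S g). Proof. by case: Sop => Sd _ _ _; exact: Sd. Qed.

Lemma op_at_linear u : dual_linear (fun g => S g u).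
Proof. by case: Sop => _ Sl _ _ a g h gd hd; rewrite Sl. Qed.

Lemma dopnorm_has_sup :
  has_sup [set dnorm nr (S g) | g in [set g : Y -> K | dual g /\ dnorm nr g <= 1]].
Proof.
case: Sop => Sd _ [M SM] _; split.
  exists (dnorm nr (S (fun _ => 0))), (fun _ => 0) => //=; split; first exact: (dual0 rs).
  by apply: dnorm_le => x _; rewrite (nrn0 rs).
exists `|M| => _ [g /= [gd g1] <-]; apply: le_trans (SM g gd) _.
apply: le_trans (ler_norm _) _; rewrite normrM -[leRHS]mulr1 ler_wpM2l//.
by rewrite ger0_norm//; exact: (dnorm_nneg rs).
Qed.

Lemma dopnorm_ub g : dual g -> dnorm nr g <= 1 -> dnorm nr (S g) <= dopnorm nr S.
Proof.
by move=> gd g1; apply: ub_le_sup; [case: dopnorm_has_sup|exists g].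
Qed.

Lemma dopnorm_ge0 : 0 <= dopnorm nr S.
Proof.
have d0 := dual0 rs Y; apply: le_trans (dopnorm_ub d0 _).
  by apply: (dnorm_nneg rs); exact: op_dual.
by apply: dnorm_le => x _; rewrite (nrn0 rs).
Qed.

Lemma dopnormP g : dual g -> dnorm nr (S g) <= dopnorm nr S * dnorm nr g.
Proof.
move=> gd; have [g0|g0] := eqVneq (dnorm nr g) 0.
  by case: Sop => _ _ [M SM] _; have := SM g gd; rewrite g0 !mulr0.
have dg0 : 0 < dnorm nr g by rewrite lt_neqAle eq_sym g0; exact: (dnorm_nneg rs).
have i0 : 0 <= (dnorm nr g)^-1 by rewrite invr_ge0 ltW.
pose g' y := iota (dnorm nr g)^-1 * g y + 0.
have g'd : dual g' by apply: (dualP rs) => //; exact: (dual0 rs).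
have g'1 : dnorm nr g' <= 1.
  apply: dnorm_le => y y1; rewrite /g' addr0 (nrnM rs) (nrn_iota rs i0).
  by rewrite ler_pdivrMl// mulr1 (dnorm_ub rs).
apply: dnorm_le => u u1.
have := le_trans (dnorm_ub rs (op_dual g'd) u1) (dopnorm_ub g'd g'1).
rewrite (op_at_linear u _ gd (dual0 rs Y)) (dual_linear0 rs (op_at_linear u)) addr0.
by rewrite (nrnM rs) (nrn_iota rs i0) ler_pdivrMl// mulrC.
Qed.

Lemma op_bound g u : dual g -> nr `|u| <= 1 ->
  nr `|S g u| <= dopnorm nr S * dnorm nr g.
Proof.
move=> gd u1; apply: le_trans (dopnormP gd).
by apply: (dnorm_ub rs); [exact: op_dual|rewrite -(nrn_le1 rs)].
Qed.

Hypothesis SVU : forall g, annih V g -> annih U (S g).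
Variables (n : nat) (x : 'I_n -> X) (h : 'I_n -> X -> K).
Hypotheses (hd : forall i, dual (h i)) (hx : forall i j, h i (x j) = (i == j)%:R).
Hypothesis Sbasis : forall g, dual g -> S g = (fun u => \sum_i S g (x i) * h i u).

(* The value at [g] of the adjoint of [S] on the element of [X] with coordinates [z]. *)
Let adj (z : 'rV[K]_n) (g : Y -> K) := \sum_j z 0 j * S g (x j).
Let crd (u : X) : 'rV[K]_n := \row_j h j u.

Lemma adj_mul z (M : 'M[K]_n) g : adj (z *m M) g = \sum_j z 0 j * adj (row j M) g.
Proof.
under [RHS]eq_bigr do rewrite mulr_sumr.
rewrite exchange_big; apply: eq_bigr => k _.
by rewrite mxE mulr_suml; apply: eq_bigr => j _; rewrite mxE mulrA.
Qed.

Lemma adjD z1 z2 g : adj (z1 + z2) g = adj z1 g + adj z2 g.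
Proof. by rewrite -big_split; apply: eq_bigr => j _ /=; rewrite mxE mulrDl. Qed.

Lemma adjZ a z g : adj (a *: z) g = a * adj z g.
Proof. by rewrite mulr_sumr; apply: eq_bigr => j _; rewrite mxE mulrA. Qed.

Lemma adj_crd u g : dual g -> adj (crd u) g = S g u.
Proof.
move=> gd; rewrite [in RHS](Sbasis gd); apply: eq_bigr => j _.
by rewrite mxE mulrC.
Qed.

Lemma crdP a u v : crd (a *: u + v) = a *: crd u + crd v.
Proof. by apply/rowP => j; rewrite !mxE (hd j).1. Qed.

Lemma adj_linear z : dual_linear (adj z).
Proof.
move=> a g k gd kd; rewrite mulr_sumr -big_split; apply: eq_bigr => j _ /=.
by rewrite (op_at_linear (x j) a gd kd) mulrDr mulrCA.
Qed.

Definition fin_op (t : 'I_n -> Y) (u : X) := \sum_j h j u *: t j.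

(** The coordinate row of a point splits along [Q], [P1] and [P3]. On the [Q] part the adjoint of
    [S] has values in [Y] itself, given by the vectors [b]; on the [P1] part its values kill the
    annihilator of [V], so Helly replaces them inside [V]; on the [P3] part the replacements may be
    any vectors of [Y]. *)
Lemma finite_reflexivity (I : finType) (xs : I -> X) (q : nat)
    (phi : 'I_q -> Y -> K) (e : R) :
  (forall i, nr `|xs i| <= 1) -> (forall p, dual (phi p)) -> 0 < e ->
  exists t : 'I_n -> Y,
    [/\ forall u, U u -> V (fin_op t u),
        forall i, nr `|fin_op t (xs i)| <= dopnorm nr S + e,
        forall p u, phi p (fin_op t u) = S (phi p) u
      & forall c : 'I_n -> K,
          (exists y, forall g, dual g -> \sum_j c j * S g (x j) = g y) ->
          forall g, dual g -> g (\sum_j c j *: t j) = \sum_j c j * S g (x j)].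
Proof.
move=> xs1 phid e0; have [_ V0 VP] := Vs; have [_ U0 UP] := Us.
pose ZU : set 'rV[K]_n := [set z | exists2 u, U u & z = crd u].
pose ZY : set 'rV[K]_n := [set z | exists y, forall g, dual g -> adj z g = g y].
have [||B BP] := @row_space_of_set _ _ ZU.
- by exists 0 => //; apply/rowP => j; rewrite !mxE (lf0 (hd j).1).
- by move=> a _ _ [u Uu ->] [v Uv ->]; exists (a *: u + v); [exact: UP|rewrite crdP].
have [||A AP] := @row_space_of_set _ _ ZY.
- exists 0 => g [gl _]; rewrite (lf0 gl) /adj big1// => j _.
  by rewrite mxE mul0r.
- move=> a y z [y' Hy] [z' Hz]; exists (a *: y' + z') => g gd.
  by rewrite adjD adjZ Hy// Hz// gd.1.
have [Q [P1 [P3 [sum1 [QA P1B] [AP1 AP3] [BP3 BQ] P11]]]] := adapted_splitting A B.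
have /choice[b bP] j : ZY (row j Q) by apply/AP; exact: submx_trans (row_sub _ _) QA.
pose J : finType := ('I_n + 'I_n)%type.
pose VJ (j : J) : set Y := if j is inl _ then V else setT.
pose w (j : J) (g : Y -> K) :=
  match j with inl k => adj (row k P1) g | inr k => S g (x k) end.
pose lam (i : I) (j : J) : K :=
  match j with inl k => (crd (xs i) *m P1) 0 k | inr k => (crd (xs i) *m P3) 0 k end.
pose bI (i : I) := \sum_j crd (xs i) 0 j *: b j.
have gb (z : 'rV[K]_n) g : dual g -> g (\sum_j z 0 j *: b j) = adj (z *m Q) g.
  move=> gd; rewrite (lf_sum gd.1) adj_mul; apply: eq_bigr => j _.
  by rewrite (lfZ gd.1) bP.
have adj3 (z : 'rV[K]_n) g : adj z g = adj (z *m Q) g + adj (z *m P1) g + adj (z *m P3) g.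
  by rewrite -!adjD -!mulmxDr sum1 mulmx1.
(* [w (inl k)] uses row [k] of [P1] instead of a unit row, so that it kills the annihilator of [V];
   idempotence of [P1] keeps the sum unchanged. *)
have w1 (z : 'rV[K]_n) g : \sum_k (z *m P1) 0 k * w (inl k) g = adj (z *m P1) g.
  by rewrite -adj_mul -mulmxA P11.
have [|||||||v [vV vphi vb]] := @helly _ _ _ _ rs Y I J VJ q phi w bI lam (dopnorm nr S) e.
- case=> k /=; first by split.
  by split.
- exact: phid.
- by case=> k; [exact: adj_linear|exact: op_at_linear].
- case=> k g /= gV.
    have /BP[u Uu ->] : (row k P1 <= B)%MS by exact: submx_trans (row_sub _ _) P1B.
    by rewrite adj_crd; [case: (SVU gV) => _; exact|case: gV].
  have -> : g = (fun _ => 0) by apply/funext => y; case: gV => _; exact.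
  exact: (dual_linear0 rs (op_at_linear (x k))).
- exact: dopnorm_ge0.
- exact: e0.
- move=> i g gd; rewrite big_sumType /= gb// w1 addrA -/(adj _ _).
  by rewrite -adj3 adj_crd// op_bound.
pose t j := b j + (\sum_k P1 j k *: v (inl k) + \sum_k P3 j k *: v (inr k)).
have swap (z : 'rV[K]_n) (M : 'M[K]_n) (y : 'I_n -> Y) :
    \sum_j z 0 j *: (\sum_k M j k *: y k) = \sum_k (z *m M) 0 k *: y k.
  under eq_bigr do rewrite scaler_sumr.
  rewrite exchange_big; apply: eq_bigr => k _; rewrite mxE scaler_suml.
  by apply: eq_bigr => j _; rewrite scalerA.
have tE (z : 'rV[K]_n) : \sum_j z 0 j *: t j = \sum_j z 0 j *: b j +
    (\sum_k (z *m P1) 0 k *: v (inl k) + \sum_k (z *m P3) 0 k *: v (inr k)).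
  rewrite -!swap -!big_split; apply: eq_bigr => j _ /=.
  by rewrite !scalerDr.
have opE u : fin_op t u = \sum_j crd u 0 j *: t j.
  by apply: eq_bigr => j _; rewrite mxE.
exists t; split.
- move=> u Uu; rewrite opE tE.
  have uB : (crd u <= B)%MS by apply/BP; exists u.
  have -> : crd u *m P3 = 0.
    by have /submxP[D ->] := uB; rewrite -mulmxA BP3 mulmx0.
  rewrite [X in _ + (_ + X)]big1 ?addr0; last by move=> k _; rewrite mxE scale0r.
  apply: lin_subspaceD => //.
    (* The row [crd u *m Q] is again the coordinate row of a point of [U], so the annihilator of [V]
       kills the [b] part, which thus lies in the closed [V]. *)
    apply: (annih_separates rs Vs) => g gV; have [gd _] := gV; rewrite gb//.
    have /BP[u' Uu' ->] : (crd u *m Q <= B)%MS.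
      by apply: submx_trans BQ; exact: submxMr.
    by rewrite adj_crd//; case: (SVU gV) => _; exact.
  apply: lin_subspace_sum => // k; apply: lin_subspaceZ => //.
  exact: (vV (inl k)).
- move=> i; have := vb i; rewrite big_sumType /=.
  by rewrite opE tE.
- move=> p u; have pl := (phid p).1.
  rewrite opE tE (lfD pl) (lfD pl) gb// -(adj_crd u (phid p)) [RHS]adj3 -addrA.
  rewrite -w1 !(lf_sum pl); congr (_ + (_ + _)); apply: eq_bigr => k _.
    by rewrite (lfZ pl) vphi.
  by rewrite (lfZ pl) vphi.
- move=> c [y yP] g gd; pose z : 'rV[K]_n := \row_j c j.
  (* Rows of [A] have no [P1] or [P3] part, so only the exact vectors [b] enter. *)
  have zY : (z <= A)%MS.
    apply/AP; exists y => g' g'd; rewrite -yP//.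
    by apply: eq_bigr => j _; rewrite mxE.
  have [D zE] := submxP zY.
  have zP1 : z *m P1 = 0 by rewrite zE -mulmxA AP1 mulmx0.
  have zP3 : z *m P3 = 0 by rewrite zE -mulmxA AP3 mulmx0.
  have -> : \sum_j c j *: t j = \sum_j z 0 j *: t j.
    by apply: eq_bigr => j _; rewrite mxE.
  have sum0 (y' : 'I_n -> Y) : \sum_k (0 : 'rV[K]_n) 0 k *: y' k = 0.
    by rewrite big1// => k _; rewrite mxE scale0r.
  have adj0 : adj 0 g = 0 by rewrite /adj big1// => k _; rewrite mxE mul0r.
  rewrite tE zP1 zP3 !sum0 !addr0.
  have -> : \sum_j c j * S g (x j) = adj z g.
    by apply: eq_bigr => j _; rewrite mxE.
  by rewrite gb// [RHS]adj3 zP1 zP3 adj0 !addr0.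
Qed.

Lemma fin_opP t a u v : fin_op t (a *: u + v) = a *: fin_op t u + fin_op t v.
Proof.
rewrite scaler_sumr -big_split; apply: eq_bigr => j _ /=.
by rewrite (hd j).1 scalerDl scalerA.
Qed.

Lemma fin_opB t u v : fin_op t (u - v) = fin_op t u - fin_op t v.
Proof. by rewrite addrC -scaleN1r fin_opP scaleN1r addrC. Qed.

Lemma fin_op_basis t j : fin_op t (x j) = t j.
Proof.
rewrite /fin_op (bigD1 j)//= hx eqxx scale1r big1 ?addr0// => i ij.
by rewrite hx (negbTE ij) scale0r.
Qed.

Lemma fin_op_fin_rank t : fin_rank_op (fin_op t).
Proof.
split; first exact: fin_opP.
  apply: (bounded_continuous rs (M := \sum_j dnorm nr (h j) * nr `|t j|)).
    exact: fin_opB.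
  move=> u; apply: le_trans (nrn_sum rs _) _; rewrite mulr_suml.
  apply: ler_sum => j _; rewrite (nrnZ rs) mulrAC ler_wpM2r ?nge0//.
  exact: (dnormP rs).
by exists n, t => u; exists (fun j => h j u).
Qed.

(* The coordinates of the unit ball form a bounded subset of a finite-dimensional
   space: bounds at a finite net and at the [x j] control the whole operator. *)
Lemma ball_reflexivity (q : nat) (phi : 'I_q -> Y -> K) (e : R) :
  (forall p, dual (phi p)) -> 0 < e ->
  exists t : 'I_n -> Y,
    [/\ forall u, U u -> V (fin_op t u),
        forall u, nr `|u| <= 1 -> nr `|fin_op t u| <= dopnorm nr S + e,
        forall p u, phi p (fin_op t u) = S (phi p) u
      & forall c : 'I_n -> K,
          (exists y, forall g, dual g -> \sum_j c j * S g (x j) = g y) ->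
          forall g, dual g -> g (\sum_j c j *: t j) = \sum_j c j * S g (x j)].
Proof.
move=> phid e0; set s := dopnorm nr S; have s0 : 0 <= s by exact: dopnorm_ge0.
(* Dividing by [kap j] puts [x j] in the unit ball; the added 1 keeps the divisor positive. *)
pose kap j := nr `|x j| + 1.
have kap0 j : 0 < kap j by rewrite ltr_wpDl ?nge0.
pose k := \sum_j kap j.
have k0 : 0 <= k by apply: sumr_ge0 => j _; exact/ltW.
pose e' := e / 2; have e'0 : 0 < e' by exact: divr_gt0.
(* With this mesh [2 * d * (k * (s + e'))] is at most [e'], the half of [e] left for passing from
   the net to the ball. *)
pose d := e' / (2 * (k * (s + e') + 1)).
have se0 : 0 <= s + e' by rewrite addr_ge0// ltW.
have ks0 : 0 < k * (s + e') + 1 by rewrite ltr_wpDl// mulr_ge0.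
have d0 : 0 < d by rewrite divr_gt0// mulr_gt0.
have [N [c cP]] := bounded_net rs (\sum_j dnorm nr (h j)) d0.
have hc u j : nr `|u| <= 1 -> exists i, nr `|h j u - c i| <= d.
  move=> u1; apply: cP; apply: le_trans (dnorm_ub rs (hd j) _) _.
    by rewrite -(nrn_le1 rs).
  rewrite (bigD1 j)//= lerDl; apply: sumr_ge0 => i _; exact: (dnorm_nneg rs).
pose near (r : {ffun 'I_n -> N}) u := nr `|u| <= 1 /\
  forall j, nr `|h j u - c (r j)| <= d.
(* Each nonempty cell of the net is represented by one of its points; an empty cell gets 0. *)
have /choice[rep repP] (r : {ffun 'I_n -> N}) :
    exists u, nr `|u| <= 1 /\ ((exists u', near r u') -> near r u).
  have [[u nu]|no] := pselect (exists u', near r u'); first by exists u; split=> //; case: nu.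
  by exists 0; rewrite (nrn0 rs).
pose xs (i : {ffun 'I_n -> N} + 'I_n) := match i with
  | inl r => rep r | inr j => iota (kap j)^-1 *: x j end.
have xs1 i : nr `|xs i| <= 1.
  case: i => [r|j] /=; first by case: (repP r).
  rewrite (nrnZ rs) (nrn_iota rs) ?invr_ge0 ?(ltW (kap0 j))// ler_pdivrMl// mulr1.
  by rewrite lerDl.
have [t [tU tb tphi tc]] := finite_reflexivity xs1 phid e'0.
exists t; split=> // u u1.
have /choice[i iP] j := hc u j u1.
pose r := [ffun j => i j].
have [rep1 /(_ _)[|_ repd]] := repP r.
  by exists u; split=> // j; rewrite ffunE.
have tj j : nr `|t j| <= kap j * (s + e').
  have := tb (inr j); rewrite /= -[_ *: x j]addr0 fin_opP fin_op_basis.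
  have -> : fin_op t 0 = 0 by rewrite -(subrr 0) fin_opB subrr.
  rewrite addr0 (nrnZ rs) (nrn_iota rs) ?invr_ge0 ?(ltW (kap0 j))//.
  by rewrite ler_pdivrMl.
have -> : fin_op t u = fin_op t (rep r) + fin_op t (u - rep r).
  by rewrite fin_opB addrC subrK.
apply: le_trans (nrnD rs _ _) _.
have -> : s + e = s + e' + e' by rewrite /e'; lra.
apply: lerD; first exact: (tb (inl r)).
apply: (@le_trans _ _ (2 * d * (k * (s + e')))); last first.
  have -> : 2 * d = e' / (k * (s + e') + 1) by rewrite /d; field; rewrite gt_eqF.
  rewrite mulrAC ler_pdivrMr//.
  by rewrite ler_wpM2l ?(ltW e'0)// lerDl.
apply: le_trans (nrn_sum rs _) _; rewrite mulr_suml mulr_sumr.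
apply: ler_sum => j _; rewrite (nrnZ rs) ler_pM ?nge0//.
rewrite (lfB (hd j).1).
have -> : h j u - h j (rep r) = (h j u - c (i j)) + - (h j (rep r) - c (i j)) by ring.
apply: le_trans (nrnD rs _ _) _; rewrite (nrnN).
have := iP j; have := repd j; rewrite ffunE; lra.
Qed.

End FiniteRank.

(** * The net *)

Section Nets.
Variables (R : realType) (K : numFieldType) (nr : K -> R) (iota : {rmorphism R -> K}).
Hypothesis rs : real_scalars nr iota.

Let nge0 := nrn_ge0 rs.

Lemma opnorm_le (X Y : normedModType K) (T : X -> Y) (c : R) :
  (forall u, nr `|u| <= 1 -> nr `|T u| <= c) -> opnorm nr T <= c.
Proof.
move=> Tc; apply: ge_sup; first by exists (nr `|T 0|), 0 => //=; rewrite normr0.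
by move=> _ [u /= u1 <-]; apply: Tc; rewrite (nrn_le1 rs).
Qed.

Lemma opnorm_ub (X Y : normedModType K) (T : X -> Y) (c : R) u :
  (forall u, nr `|u| <= 1 -> nr `|T u| <= c) -> nr `|u| <= 1 -> nr `|T u| <= opnorm nr T.
Proof.
move=> Tc u1; apply: ub_le_sup; last by exists u => //=; rewrite -(nrn_le1 rs).
by exists c => _ [v /= v1 <-]; apply: Tc; rewrite (nrn_le1 rs).
Qed.

(** The [h j] are chosen as a basis of the range of [S]. The family [psi] is quantified after [h],
    so that exactness on the [h j] themselves can be requested. *)
Lemma exists_good_net (X Y : normedModType K) (U : set X) (V : set Y)
    (S : (Y -> K) -> (X -> K)) (F : set (Y -> K)) :
  closed_subspace U -> closed_subspace V -> dual_fin_rank_op nr S ->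
  (forall g, annih V g -> annih U (S g)) -> findim_dual_subspace F ->
  exists (n : nat) (h : 'I_n -> X -> K),
    (forall j, exists2 g, dual g & h j = S g) /\
    forall (r : nat) (psi : 'I_r -> Y -> K), (forall k, dual (psi k)) ->
    exists (I : Type) (le : I -> I -> Prop) (t : I -> 'I_n -> Y),
      good_net nr U V S F le (fun i => fin_op h (t i)) /\
      forall i k u, psi k (fin_op h (t i) u) = S (psi k) u.
Proof.
move=> Us Vs Sop SVU [Fd F0 FP [nF [eF FeF]]].
have Sl u := op_at_linear Sop u.
have Ssum (I : finType) (c : I -> K) (g : I -> Y -> K) u : (forall i, dual (g i)) ->
    S (fun y => \sum_i c i * g i y) u = \sum_i c i * S (g i) u.
  by move=> gd; exact: (dual_linear_sum rs c (Sl u) gd).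
have [nS [eS [_ SeS]]] : exists n (e : 'I_n -> X -> K), (forall i, dual (e i)) /\
    forall g, dual g -> exists c : 'I_n -> K, S g = (fun x => \sum_(i < n) c i * e i x).
  by case: Sop.
pose ranS := [set S g | g in dual (X := Y)].
have [|||n [x [h [hS hx Sh]]]] := @biorthogonal_basis X K ranS nS eS.
- exists (fun _ => 0); first exact: (dual0 rs).
  by apply/funext => u; exact: (dual_linear0 rs (Sl u)).
- move=> a _ _ [g gd <-] [k kd <-]; exists (fun y => a * g y + k y).
    exact: (dualP rs).
  by apply/funext => u; exact: Sl.
- by move=> _ [g gd <-]; exact: SeS.
have Sbasis g : dual g -> S g = (fun u => \sum_i S g (x i) * h i u).
  by move=> gd; apply: Sh; exists g.
(* Exactness on preimages [gam j] of the [h j] puts each [h j] in the range of the adjoint of the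
   operator. *)
have /choice[gam gamP] j : exists g : Y -> K, dual g /\ S g = h j.
  by have [g] := hS j; exists g.
have gamd j : dual (gam j) by case: (gamP j).
have gamS j : S (gam j) = h j by case: (gamP j).
have hd j : dual (h j) by rewrite -gamS; exact: (op_dual Sop).
have [mF [xF [f [fF _ Ff]]]] := biorthogonal_basis F0 FP FeF.
exists n, h; split=> [j|r psi psid]; first by exists (gam j).
pose I := (seq (Y -> K) * nat)%type.
pose le (a b : I) := {subset a.1 <= b.1} /\ (a.2 <= b.2)%N.
(* Exactness at index [a] is imposed on a basis of [F], the [gam j], the [psi k], and those entries
   of the index that belong to the dual. *)
pose L (a : I) := [seq f i | i <- enum 'I_mF] ++ [seq gam i | i <- enum 'I_n] ++
  [seq psi k | k <- enum 'I_r] ++ [seq g <- a.1 | `[< dual g >]].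
have Ld a g : g \in L a -> dual g.
  rewrite !mem_cat => /or4P[/mapP[i _ ->]|/mapP[i _ ->]|/mapP[k _ ->]|] //.
    exact: Fd.
  by rewrite mem_filter => /andP[/asboolP].
have /choice[t tP] (a : I) : exists t : 'I_n -> Y,
    [/\ forall u, U u -> V (fin_op h t u),
        forall u, nr `|u| <= 1 -> nr `|fin_op h t u| <= dopnorm nr S + a.2.+1%:R^-1,
        forall g u, g \in L a -> g (fin_op h t u) = S g u
      & forall c : 'I_n -> K,
          (exists y, forall g, dual g -> \sum_j c j * S g (x j) = g y) ->
          forall g, dual g -> g (\sum_j c j *: t j) = \sum_j c j * S g (x j)].
  have [||t [tU tb tphi tc]] := @ball_reflexivity _ _ _ _ rs X Y U V S Us Vs Sop SVU n x h
      hd hx Sbasis (size (L a)) (fun p => nth (fun _ => 0) (L a) p) a.2.+1%:R^-1.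
  - by move=> p; apply: (Ld a); exact: mem_nth.
  - by rewrite invr_gt0 ltr0n.
  exists t; split=> // g u gL.
  have gi : (index g (L a) < size (L a))%N by rewrite index_mem.
  by have := tphi (Ordinal gi) u; rewrite /= nth_index.
have tL a g u : g \in L a -> g (fin_op h (t a) u) = S g u by case: (tP a) => _ _ + _; exact.
have t_le a g u : dual g -> g \in a.1 -> g (fin_op h (t a) u) = S g u.
  move=> gd ga; apply: tL; rewrite !mem_cat; apply/or4P/Or44.
  by rewrite mem_filter ga andbT; apply/asboolP.
have t_f a i u : f i (fin_op h (t a) u) = S (f i) u.
  by apply: tL; rewrite !mem_cat map_f// mem_enum.
have t_gam a j u : gam j (fin_op h (t a) u) = h j u.
  rewrite -gamS; apply: tL; rewrite !mem_cat; apply/or4P/Or42.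
  by apply: map_f; rewrite mem_enum.
exists I, le, t; split; last first.
  move=> a k u; apply: tL; rewrite !mem_cat; apply/or4P/Or43.
  by apply: map_f; rewrite mem_enum.
have gop a g u : dual g -> g (fin_op h (t a) u) = \sum_j g (t a j) * h j u.
  move=> [gl _]; rewrite (lf_sum gl); apply: eq_bigr => j _.
  by rewrite (lfZ gl) mulrC.
split.
- split; last by move=> a; exact: (fin_op_fin_rank rs).
  split.
  + exact: (inhabits ([::], 0%N)).
  + by move=> a; split.
  + move=> a b c [ab1 ab2] [bc1 bc2]; split; first by move=> g /ab1 /bc1.
    exact: leq_trans bc2.
  + move=> a b; exists (a.1 ++ b.1, maxn a.2 b.2).
    split; split=> [g ga|] /=; rewrite ?leq_maxl ?leq_maxr// mem_cat ga ?orbT//.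
- by move=> a; case: (tP a).
- move=> e e0.
  (* A nearly norming [g] in the index gives the lower bound, the precision [k] the upper one. *)
  have [_ [g /= [gd g1] <-] sg] := sup_adherent e0 (dopnorm_has_sup rs Sop).
  have [k] := ltr_add_invr e0; rewrite add0r => ke.
  exists ([:: g], k) => a [ga ka]; have [_ tb _ _] := tP a.
  have ga' : g \in a.1 by apply: ga; rewrite mem_head.
  have upper : opnorm nr (fin_op h (t a)) < dopnorm nr S + e.
    apply: le_lt_trans (opnorm_le tb) _; rewrite ltrD2l; apply: le_lt_trans ke.
    by rewrite lef_pV2 ?posrE ?ltr0n// ler_nat.
  have lower : dopnorm nr S - e < opnorm nr (fin_op h (t a)).
    apply: lt_le_trans sg _; apply: dnorm_le => u; rewrite -(nrn_le1 rs) => u1.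
    rewrite -(t_le a g u gd ga'); apply: le_trans (dnormP rs _ gd) _.
    rewrite -[leRHS]mul1r ler_pM ?nge0 ?(dnorm_nneg rs)//.
    exact: (opnorm_ub tb).
  by rewrite ltr_norml; apply/andP; split; lra.
- split; [|split].
  (* [S] and the adjoint of the operator both send [gam j] to [h j], and the [h j] span both
     ranges. *)
  + move=> a; apply/seteqP; split=> _ [g gd <-].
      exists (fun y => \sum_j g (t a j) * gam j y); first exact: (dual_sum rs).
      apply/funext => u; rewrite Ssum// gop//.
      by apply: eq_bigr => j _; rewrite gamS.
    exists (fun y => \sum_j S g (x j) * gam j y); first exact: (dual_sum rs).
    apply/funext => u; rewrite [RHS](congr1 (fun k => k u) (Sbasis g gd)).
    by apply: eq_bigr => j _; rewrite t_gam.
  (* The two sides coincide as soon as [g] belongs to the index. *)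
  + move=> g gd e e0; exists ([:: g], 0%N) => a [ga _].
    have -> : (fun u => g (fin_op h (t a) u) - S g u) = (fun _ => 0).
      by apply/funext => u; rewrite t_le ?subrr//; apply: ga; rewrite mem_head.
    have -> : dnorm nr (fun _ : X => 0) = 0; last by rewrite subrr normr0.
    apply/le_anti; rewrite (dnorm_nneg rs) ?andbT; last exact: (dual0 rs).
    by apply: dnorm_le => u _; rewrite (nrn0 rs).
  + move=> a g Fg; rewrite (Ff g Fg); apply/funext => u.
    rewrite Ssum; last by move=> i; exact: Fd.
    by apply: eq_bigr => i _; rewrite t_f.
(* The composite of [P] with [S] has coordinates [P (h j)], to which the last property of [t a]
   applies. *)
- move=> a P [Pl _] [y Py] g gd; have [_ _ _ tc] := tP a.
  have Psum (c : 'I_n -> K) : P (fun u => \sum_j c j * h j u) = \sum_j c j * P (h j).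
    exact: (dual_linear_sum rs).
  have PS k : dual k -> P (S k) = \sum_j P (h j) * S k (x j).
    move=> kd; rewrite [in LHS](Sbasis k kd) Psum; apply: eq_bigr => j _.
    by rewrite mulrC.
  rewrite PS// -tc//; last by exists y => k kd; rewrite -PS// Py.
  have -> : (fun u => g (fin_op h (t a) u)) = (fun u => \sum_j g (t a j) * h j u).
    by apply/funext => u; exact: gop.
  rewrite Psum (lf_sum gd.1); apply: eq_bigr => j _.
  by rewrite (lfZ gd.1) mulrC.
Qed.

Lemma theorem3p1_scalars : theorem3p1_statement nr.
Proof.
split=> [X Y U V S F Us Vs Sop SVU Ff|X U V S F Us Vs Sop SVU Ff SS].
  have [n [h [_ /(_ 0%N (fun _ _ => 0))]]] := exists_good_net Us Vs Sop SVU Ff.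
  case=> [k|I [le [t [good _]]]]; first exact: (dual0 rs).
  by exists I, le, (fun i => fin_op h (t i)).
have [n [h [hS net]]] := exists_good_net Us Vs Sop SVU Ff.
have hd j : dual (h j) by have [g gd ->] := hS j; exact: (op_dual Sop).
(* [S] fixes each [h j], so by exactness on the [h j] the operator preserves these coordinates and
   is idempotent. *)
have [I [le [t [good th]]]] := net n h hd.
exists I, le, (fun i => fin_op h (t i)); split=> // i u.
rewrite [in LHS]/fin_op; apply: eq_bigr => j _; rewrite th.
by have [g gd ->] := hS j; rewrite SS.
Qed.

End Nets.

(** * Real and complex scalars *)

Section Instances.
Variable R : realType.

Lemma real_bounded_net (M d : R) : 0 < d -> exists (I : finType) (c : I -> R),
  forall k : R, `|k| <= M -> exists i, `|k - c i| <= d.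
Proof.
move=> d0; set N := Num.truncn (2 * M / d).
(* A grid of step [d] starts at [- M]; truncation selects the last grid point not above [k]. *)
exists 'I_N.+1, (fun i : 'I_N.+1 => i%:R * d - M) => k kM.
have kM0 : 0 <= (k + M) / d.
  by rewrite divr_ge0 ?(ltW d0)//; move: kM; rewrite ler_norml; lra.
have kle : (Num.truncn ((k + M) / d) < N.+1)%N.
  rewrite ltnS le_truncn// ler_pM2r ?invr_gt0//.
  by move: kM; rewrite ler_norml; lra.
exists (Ordinal kle) => /=.
have /andP[] := truncn_itv kM0; rewrite ler_pdivlMr// ltr_pdivrMr// -natr1.
by rewrite ler_norml; lra.
Qed.

Lemma real_real_scalars : real_scalars (@id R) (idfun : {rmorphism R -> R}).
Proof.
split=> // [E p v pD pZ|M d d0]; last exact: real_bounded_net.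
have ps : sublinear (idfun : {rmorphism R -> R}) p.
  by split=> // r x r0; rewrite pZ gtr0_norm.
have [u [uD uZ up uv]] := sublinear_support v ps.
have uN x : u (- x) = - u x by rewrite -scaleN1r -[-1]/(idfun (-1)) uZ mulN1r.
have pN x : p (- x) = p x by rewrite -scaleN1r pZ normrN normr1 mul1r.
have nu x : `|u x| <= p x.
  by rewrite ler_norml up andbT lerNl -uN -[leRHS]pN.
exists u; split=> // [a x y|]; first by rewrite uD -[a]/(idfun a) uZ.
apply/le_anti; rewrite nu /= -{1}uv; exact: ler_norm.
Qed.

Import complex.
Local Open Scope complex_scope.

Let iotaC : {rmorphism R -> R[i]} := real_complex R.

Let normCi : `|'i : R[i]| = 1.
Proof. by rewrite normc_def /= expr0n expr1n add0r sqrtr1. Qed.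

Let normCr (r : R) : `|r%:C| = `|r|%:C.
Proof. by rewrite normc_def /= expr0n addr0 sqrtr_sqr. Qed.

Let norm_Re (z : R[i]) : `|Re z| <= Re `|z|.
Proof. by have := normc_ge_Re z; rewrite lecE => /andP[]. Qed.

Lemma complex_bounded_net (M d : R) : 0 < d -> exists (I : finType) (c : I -> R[i]),
  forall k : R[i], Re `|k| <= M -> exists i, Re `|k - c i| <= d.
Proof.
move=> d0; have [I [c cP]] := real_bounded_net M (divr_gt0 d0 (ltr0Sn R 1)).
exists (I * I)%type, (fun i => c i.1 +i* c i.2) => k kM.
(* Multiplication by ['i] turns the bound on real parts into one on imaginary parts. *)
have ImK (z : R[i]) : `|Im z| <= Re `|z|.
  by have := norm_Re (z * 'i); rewrite ReiNIm normrN normrM normCi mulr1.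
have [i iP] := cP _ (le_trans (norm_Re k) kM).
have [j jP] := cP _ (le_trans (ImK k) kM).
have kE : k - (c i +i* c j) = (Re k - c i)%:C + 'i * (Im k - c j)%:C.
  by case: k {kM iP jP} => a b; simpc.
exists (i, j); rewrite [X in Re `|X|]kE.
have : Re `|(Re k - c i)%:C + 'i * (Im k - c j)%:C| <= `|Re k - c i| + `|Im k - c j|.
  have := ler_normD (Re k - c i)%:C ('i * (Im k - c j)%:C).
  by rewrite normrM normCi mul1r !normCr lecE => /andP[_].
lra.
Qed.

Lemma complex_real_scalars : real_scalars (@Re R) iotaC.
Proof.
split.
- by [].
- by move=> [a b]; rewrite lecE /= => /andP[/eqP-> _].
- by move=> r; exact: ler0c.
- move=> E p v pD pZ.
  have ps : sublinear iotaC p.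
    by split=> // r x r0; rewrite pZ -[iotaC r]/(r%:C) normCr /= gtr0_norm.
  have [u [uD uZ up uv]] := sublinear_support v ps.
  have uC (a b : R) x : u ((a +i* b) *: x) = a * u x + b * u ('i *: x).
    rewrite [a +i* b]complexE /= scalerDl uD -[a%:C]/(iotaC a) uZ; congr (_ + _).
    by rewrite mulrC -scalerA -[b%:C]/(iotaC b) uZ.
  have u0 : u 0 = 0 by rewrite -(scale0r 0) -(rmorph0 iotaC) uZ mul0r.
  have p0 x : 0 <= p x.
    have := pD x (- x); rewrite subrr -scaleN1r pZ normrN normr1 mul1r.
    have := up 0; rewrite u0 /=; lra.
  (* This is the complex-linear functional with real part [u]; rotating [psi x] onto its modulus
     reduces the norm bound to [u <= p]. *)
  pose psi x : R[i] := u x -i* u ('i *: x).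
  have psiP a x y : psi (a *: x + y) = a * psi x + psi y.
    case: a => a b; rewrite /psi scalerDr !uD (uC a b) scalerA.
    have -> : 'i * (a +i* b) = (- b) +i* a :> R[i] by simpc.
    by rewrite (uC (- b) a); simpc; congr (_ +i* _); ring.
  have psi_le x : Re `|psi x| <= p x.
    have [a [a1 <-]] := exists_phase (psi x).
    have -> : a * psi x = psi (a *: x).
      have := psiP a x 0; rewrite addr0 => ->; rewrite /psi scaler0 u0; simpc.
      by case: (_ * _) => ? ?; simpc.
    apply: le_trans (up _) _; rewrite pZ -[leRHS]mul1r ler_wpM2r//.
    by move: a1; rewrite lecE => /andP[].
  exists psi; split=> //.
  apply/le_anti; rewrite psi_le /= -uv.
  apply: le_trans (ler_norm _) _.
  exact: (norm_Re (psi v)).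
- exact: complex_bounded_net.
Qed.

End Instances.

(* real case (K = R) and complex case (K = R[i], norm values read via Re) *)
Theorem theorem3p1 (R : realType) :
  theorem3p1_statement (@id R) /\
  @theorem3p1_statement R (complex.complex R) (@complex.Re R).
Proof.
split.
  exact: theorem3p1_scalars (real_real_scalars R).
exact: theorem3p1_scalars (complex_real_scalars R).
Qed.
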